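(* For any $\varepsilon > 0$ and $p \in [1,\infty)$ there exists $C > 0$ such that the following holds. Let $f \in L^p_{loc}(\mathbb{R}^n)$, and assume $x \in \mathbb{R}^n$ is such that $$\lim_{r \to 0} \frac{1}{|B_r(x)|}\int_{B_r(x)} |f| = 0 .$$ Then for any $R > 0$ there exists $\rho \in (0,R)$ such that $$\int_{B_\rho(x)} |f|^p \leq C \left(\frac{R}{\rho}\right)^{\varepsilon} \int_{B_\rho(x)} \big||f|-(|f|)_{B_\rho(x)}\big|^p .$$
   Context: $n\ge1$ is the (fixed) dimension, $B_r(x)$ is the ball in $\mathbb{R}^n$ of radius $r$ centered at $x$, $|A|$ is the Lebesgue measure of $A$, and for a measurable set $A\subset\mathbb{R}^n$ the mean value is $(g)_A := |A|^{-1}\int_A g$. *)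

(* Defs.v *)
From HB Require Import structures.
From mathcomp Require Import all_boot all_order all_algebra.
From mathcomp Require Import all_classical all_reals all_analysis.

Set Implicit Arguments.
Unset Strict Implicit.
Unset Printing Implicit Defensive.

Import Order.TTheory GRing.Theory Num.Theory.
Import numFieldNormedType.Exports.

Local Open Scope classical_set_scope.
Local Open Scope ring_scope.

Definition measure_row_display : measure_display -> measure_display.
Proof. exact. Qed.

(* The sigma-algebra generated by the coordinates is the Borel sigma-algebra
   of R^n. *)
Section measurable_row.
Context {R : realType}.
Variable n : nat.

Let coors : 'I_n -> 'rV[R]_n -> R := fun i x => x ord0 i.

Let row_set0 : g_sigma_preimage coors set0.
Proof. exact: sigma_algebra0. Qed.

Let row_setC A : g_sigma_preimage coors A -> g_sigma_preimage coors (~` A).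
Proof. exact: sigma_algebraC. Qed.

Let row_bigcup (F : _^nat) : (forall i, g_sigma_preimage coors (F i)) ->
  g_sigma_preimage coors (\bigcup_i (F i)).
Proof. exact: sigma_algebra_bigcup. Qed.

HB.instance Definition _ := @isMeasurable.Build
  (measure_row_display default_measure_display) 'rV[R]_n
  (g_sigma_preimage coors) row_set0 row_setC row_bigcup.

Lemma measurable_coord (i : 'I_n) :
  measurable_fun [set: 'rV[R]_n] (fun x : 'rV[R]_n => x ord0 i).
Proof.
move=> _ Y mY; rewrite setTI; apply: sub_sigma_algebra => /=.
rewrite -bigcup_seq/=; exists i => /=; first by rewrite mem_index_enum.
by exists Y => //; rewrite setTI.
Qed.

End measurable_row.

Lemma measurable_fun_rowP {R : realType} d (T : measurableType d) n
    (f : T -> 'rV[R]_n) :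
  (forall i, measurable_fun [set: T] (fun x => f x ord0 i)) ->
  measurable_fun [set: T] f.
Proof.
move=> mf.
have prefS : g_sigma_preimage (fun i : 'I_n => (fun v : 'rV[R]_n => v ord0 i) \o f)
    `<=` measurable.
  apply: smallest_sub; first exact: sigma_algebra_measurable.
  rewrite -bigcup_seq/=; apply: bigcup_sub => i _.
  by move=> A [B mB <-]; exact: mf.
move=> _ A mA; apply: prefS.
by rewrite g_sigma_preimage_comp; exists A.
Qed.

Section lebesgue_measure_row.
Context {R : realType}.
Local Open Scope ereal_scope.

Definition row_cons n (z : R * 'rV[R]_n) : 'rV[R]_n.+1 :=
  row_mx (z.1%:M : 'rV_1) z.2.

Lemma row_cons0 n (z : R * 'rV[R]_n) : row_cons z ord0 ord0 = z.1.
Proof.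
rewrite mxE; case: splitP => [j _|k]//.
by rewrite (ord1 j) mxE eqxx.
Qed.

Lemma row_consS n (z : R * 'rV[R]_n) (i : 'I_n) :
  row_cons z ord0 (lift ord0 i) = z.2 ord0 i.
Proof.
rewrite mxE; case: splitP => [j|k /= []/val_inj->//].
by rewrite (ord1 j).
Qed.

Lemma measurable_row_cons n : measurable_fun [set: R * 'rV[R]_n] (@row_cons n).
Proof.
apply: measurable_fun_rowP => i; have [j ->|->] := unliftP ord0 i.
- under eq_fun do rewrite row_consS.
  exact: (measurableT_comp (measurable_coord j) measurable_snd).
- under eq_fun do rewrite row_cons0.
  exact: measurable_fst.
Qed.

Let row_tail n (v : 'rV[R]_n.+1) : 'rV[R]_n := \row_i v ord0 (lift ord0 i).

Let measurable_row_tail n : measurable_fun [set: 'rV[R]_n.+1] (@row_tail n).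
Proof.
apply: measurable_fun_rowP => i; under eq_fun do rewrite mxE.
exact: measurable_coord.
Qed.

Section lebesgue_row_step.
Variables (n : nat) (m : {sigma_finite_measure set 'rV[R]_n -> \bar R}).

Definition lebesgue_row_step : set 'rV[R]_n.+1 -> \bar R :=
  pushforward (lebesgue_measure \x m) (@row_cons n).

Let mE (A : set 'rV[R]_n.+1) : measurable A -> measurable (@row_cons n @^-1` A).
Proof. by move=> mA; rewrite -[X in measurable X]setTI; exact: measurable_row_cons. Qed.

Let step0 : lebesgue_row_step set0 = 0.
Proof. by rewrite /lebesgue_row_step /pushforward preimage_set0 measure0. Qed.

Let step_ge0 A : 0 <= lebesgue_row_step A.
Proof. by rewrite /lebesgue_row_step /pushforward; exact: measure_ge0. Qed.

Let step_sigma_additive : semi_sigma_additive lebesgue_row_step.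
Proof.
move=> F mF tF mUF; rewrite /lebesgue_row_step /pushforward preimage_bigcup.
apply: measure_semi_sigma_additive.
- by move=> k; exact: mE.
- apply/trivIsetP => /= i j _ _ ij; rewrite -preimage_setI.
  by move/trivIsetP : tF => /(_ _ _ _ _ ij) ->//; rewrite preimage_set0.
- by rewrite -preimage_bigcup; exact: mE.
Qed.

HB.instance Definition _ := isMeasure.Build _ _ _ lebesgue_row_step
  step0 step_ge0 step_sigma_additive.

Let step_sigma_finite : sigma_finite setT lebesgue_row_step.
Proof.
have /sigma_finiteP[F [TF ndF Foo]] := sigma_finiteT (@lebesgue_measure R).
have /sigma_finiteP[G [TG ndG Goo]] := sigma_finiteT m.
exists (fun k => [set v : 'rV[R]_n.+1 | F k (v ord0 ord0) /\ G k (row_tail v)]).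
  rewrite predeqE => v; split => // _.
  have [i _ Fi] : (\bigcup_i F i) (v ord0 ord0) by rewrite -TF.
  have [j _ Gj] : (\bigcup_i G i) (row_tail v) by rewrite -TG.
  exists (maxn i j) => //; split.
  - by move: Fi; exact/subsetPset/ndF/leq_maxl.
  - by move: Gj; exact/subsetPset/ndG/leq_maxr.
move=> k; have [mF Fkoo] := Foo k; have [mG Gkoo] := Goo k; split.
  rewrite -[X in measurable X]setTI; apply: measurableI => //.
  apply: measurableI.
  - by rewrite -[X in measurable X]setTI; exact: measurable_coord.
  - by rewrite -[X in measurable X]setTI; exact: measurable_row_tail.
rewrite /lebesgue_row_step /pushforward.
rewrite (_ : _ @^-1` _ = F k `*` G k).
  by rewrite product_measure1E// lte_mul_pinfty// ge0_fin_numE.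
have tailK z : row_tail (@row_cons n z) = z.2.
  by apply/rowP => i; rewrite mxE row_consS.
by apply/seteqP; split=> z /=; rewrite row_cons0 tailK.
Qed.

HB.instance Definition _ := @Measure_isSigmaFinite.Build _ _ _
  lebesgue_row_step step_sigma_finite.

End lebesgue_row_step.

(* The n-fold product of the Lebesgue measure of R, on the Borel sets of R^n. *)
Fixpoint borel_lebesgue n : {sigma_finite_measure set 'rV[R]_n -> \bar R} :=
  if n is n'.+1 return {sigma_finite_measure set 'rV[R]_n -> \bar R}
  then lebesgue_row_step (borel_lebesgue n') else \d_(0%R : 'rV[R]_0).

(* Carrier R^n equipped with the sigma-algebra of Lebesgue-measurable sets. *)
Definition lebesgue_space n := caratheodory_type ((borel_lebesgue n)^*)%mu.

Definition lebesgue_row n : set (lebesgue_space n) -> \bar R :=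
  @completed_measure_extension _ _ _ (borel_lebesgue n).
HB.instance Definition _ n := Measure.on (@lebesgue_row n).

End lebesgue_measure_row.
Arguments lebesgue_row {R} n.

Section euclidean_space.
Context {R : realType} {n : nat}.
Implicit Types (x v : 'rV[R]_n) (f : 'rV[R]_n -> R) (A : set 'rV[R]_n).

(* The library norm on 'rV[R]_n is the sup norm. *)
Definition eucl_norm v : R := Num.sqrt (\sum_i v ord0 i ^+ 2).

Definition eucl_ball x (r : R) : set 'rV[R]_n :=
  [set y | eucl_norm (y - x) < r].

Definition Lp_loc (p : R) f :=
  measurable_fun [set: lebesgue_space n] f /\
  forall K : set 'rV[R]_n, compact K ->
    (\int[lebesgue_row n]_(y in K) (`|f y| `^ p)%:E < +oo)%E.

Definition mean_value f A : R :=
  (fine (lebesgue_row n A))^-1 * \int[lebesgue_row n]_(y in A) f y.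

End euclidean_space.

(* Main.v *)
Require Import Defs.
From HB Require Import structures.
From mathcomp Require Import all_boot all_order all_algebra.
From mathcomp Require Import all_classical all_reals all_analysis.
From mathcomp Require Import measurable_realfun ring lra.

Set Implicit Arguments.
Unset Strict Implicit.
Unset Printing Implicit Defensive.

Import Order.TTheory GRing.Theory Num.Theory.
Import numFieldNormedType.Exports.

Local Open Scope classical_set_scope.
Local Open Scope ring_scope.

(** Suppose the inequality fails at every [rho_k = r0 / 2 ^ (k + 1)], and let
    [m_k] be the mean of [|f|] on the ball [B_k] of radius [rho_k].  Splitting
    [|f| <= ||f| - m_k| + m_k] then bounds the oscillation of [|f|] on [B_k]
    by [C^-1 (rho_k / r0) ^ eps |B_k| m_k ^ p] up to a constant, and doubling
    gives [m_(k+1) >= (1 - 2 delta q ^ k) m_k] with [q = 2 ^ (- eps / p) < 1]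
    and [delta] as small as we like when [C] is large.  The product of these
    factors stays above 1/2, so [m_k] cannot tend to 0.  The means are
    nonzero: if [m_k = 0], both sides have the same integral, and the
    inequality holds because its constant is at least 1. *)

(** * Inequalities between real powers, and the recursion for the means *)

Lemma powRD_le (R : realType) (a b p : R) : 0 <= a -> 0 <= b -> 0 <= p ->
  (a + b) `^ p <= 2 `^ p * (a `^ p + b `^ p).
Proof.
move=> a0 b0 p0.
wlog ab : a b a0 b0 / a <= b.
  move=> H; have [/H|/ltW /H] := leP a b; first exact.
  by rewrite addrC [X in _ * X]addrC; exact.
apply: (@le_trans _ _ ((2 * b) `^ p)).
  by apply: ge0_ler_powR; rewrite ?nnegrE//; lra.
rewrite powRM// ler_wpM2l ?powR_ge0//.
by rewrite lerDr powR_ge0.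
Qed.

(* Interpolating between [t <= s] and [s <= t] replaces Hölder's inequality
   when comparing means. *)
Lemma le_powR_interp (R : realType) (t s p : R) : 0 <= t -> 0 < s -> 1 <= p ->
  t <= s + s `^ (1 - p) * t `^ p.
Proof.
move=> t0 s0 p1; have [ts|/ltW st] := leP t s.
  by rewrite (le_trans ts)// lerDl mulr_ge0// powR_ge0.
have tgt0 : 0 < t by exact: lt_le_trans st.
apply: (@le_trans _ _ (s `^ (1 - p) * t `^ p)); last by rewrite lerDr ltW.
have {1}-> : t = t `^ (1 - p) * t `^ p.
  by rewrite -powRD ?subrK ?powRr1 ?gt_eqF ?implybT.
rewrite ler_wpM2r ?powR_ge0//.
rewrite -opprB !powRN lef_pV2 ?posrE ?powR_gt0//.
by apply: ge0_ler_powR; rewrite ?nnegrE ?subr_ge0// ltW.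
Qed.

(** The product of the factors is not estimated directly. The stronger bound
    [(1 + q ^ k) / 2 * m 0 <= m k] passes through the induction, with the nonnegative remainder
    [(1 - q) * q ^ k * (1 - q ^ k) / 4 * m 0]. *)
Lemma ge_half_of_geometric_steps (R : realType) (q : R) (m : nat -> R) :
  0 < q < 1 -> (forall k, 0 < m k) ->
  (forall k, (1 - 2 * ((1 - q) / 4 * q ^+ k)) * m k <= m k.+1) ->
  forall k, m 0%N / 2 <= m k.
Proof.
move=> /andP[q0 q1] m0 H k.
suff Hk : (1 + q ^+ k) / 2 * m 0%N <= m k.
  apply: le_trans Hk.
  have : 0 <= q ^+ k * m 0%N by rewrite mulr_ge0 ?exprn_ge0 ?ltW.
  lra.
elim: k => [|k IH]; first by rewrite expr0 divff ?mul1r.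
apply: le_trans (H k).
have qk0 : 0 <= q ^+ k by rewrite exprn_ge0 ?ltW.
have qk1 : q ^+ k <= 1 by rewrite exprn_ile1 ?ltW.
have a0 : 0 <= 1 - 2 * ((1 - q) / 4 * q ^+ k) by nra.
apply: le_trans (ler_wpM2l a0 IH).
rewrite [leRHS]mulrA ler_wpM2r ?(ltW (m0 _))// exprS.
have : 0 <= (1 - q) * q ^+ k * (1 - q ^+ k) by rewrite !mulr_ge0 ?subr_ge0// ltW.
lra.
Qed.

(** * Oscillation and means on sets of finite measure *)

Section oscillation.
Context d (T : measurableType d) (R : realType) (mu : {measure set T -> \bar R}).
Implicit Types (A B : set T) (g : T -> R) (c p s : R).

Lemma integrable_powR_dist B g c p : measurable B -> (mu B < +oo)%E ->
  measurable_fun B g -> (forall y, 0 <= g y) -> 0 <= p ->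
  mu.-integrable B (fun y => (g y `^ p)%:E) ->
  mu.-integrable B (fun y => (`|g y - c| `^ p)%:E).
Proof.
move=> mB fB mg g0 p0 ig.
have ic k : mu.-integrable B (fun=> k%:E).
  by apply: measurable_bounded_integrable; [| |exact: measurable_cst|
    exact: bounded_cst].
apply: (@le_integrable _ _ _ mu B mB _
   (fun y => (2 `^ p)%:E * ((g y `^ p)%:E + (`|c| `^ p)%:E))%E).
- apply/measurable_EFinP; apply: (measurableT_comp (measurable_powR p)).
  by apply: measurableT_comp => //; exact: measurable_funB.
- move=> y _ /=; rewrite lee_fin.
  rewrite [leLHS]ger0_norm ?powR_ge0// [leRHS]ger0_norm; last first.
    by rewrite mulr_ge0 ?addr_ge0 ?powR_ge0.
  apply: le_trans (powRD_le (g0 y) (normr_ge0 c) p0).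
  apply: ge0_ler_powR; rewrite ?nnegrE ?addr_ge0//.
  by rewrite (le_trans (ler_normB _ _))// ger0_norm.
- by apply: integrableZl => //; apply: integrableD.
Qed.

(** The interpolation inequality at [s = 1] dominates [g] by [1 + g ^ p]. *)
Lemma integrable_of_powR B g p : measurable B -> (mu B < +oo)%E ->
  measurable_fun B g -> (forall y, 0 <= g y) -> 1 <= p ->
  mu.-integrable B (fun y => (g y `^ p)%:E) ->
  mu.-integrable B (EFin \o g).
Proof.
move=> mB fB mg g0 p1 ig.
apply: (@le_integrable _ _ _ mu B mB _
   (fun y => (1%:E + (g y `^ p)%:E))%E).
- exact/measurable_EFinP.
- move=> y _ /=; rewrite lee_fin !ger0_norm ?addr_ge0 ?powR_ge0//.
  by have := le_powR_interp (g0 y) ltr01 p1; rewrite powR1 mul1r.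
- apply: integrableD => //.
  by apply: measurable_bounded_integrable; [| |exact: measurable_cst|
    exact: bounded_cst].
Qed.

Lemma Rintegral_powR_le B g c p : measurable B -> (mu B < +oo)%E ->
  measurable_fun B g -> (forall y, 0 <= g y) -> 0 <= p ->
  mu.-integrable B (fun y => (g y `^ p)%:E) ->
  \int[mu]_(y in B) (g y `^ p) <=
  2 `^ p * (\int[mu]_(y in B) (`|g y - c| `^ p) + `|c| `^ p * fine (mu B)).
Proof.
move=> mB fB mg g0 p0 ig.
have ic k : mu.-integrable B (EFin \o (fun=> k)).
  by apply: measurable_bounded_integrable; [| |exact: measurable_cst|
    exact: bounded_cst].
have iD := integrable_powR_dist c mB fB mg g0 p0 ig.
have iS : mu.-integrable B (EFin \o (fun y => `|g y - c| `^ p + `|c| `^ p)).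
  exact: (integrableD mB iD (ic _)).
rewrite -Rintegral_cst// -RintegralD// -RintegralZl//.
apply: le_Rintegral => //; first exact: (integrableZl mB _ iS).
move=> y _; apply: le_trans (powRD_le (normr_ge0 _) (normr_ge0 c) p0).
apply: ge0_ler_powR; rewrite ?nnegrE ?addr_ge0// -[leLHS](ger0_norm (g0 y)).
by rewrite -{1}(subrK c (g y)) ler_normD.
Qed.

(** Averaging [|g - c| <= s + s ^ (1 - p) * |g - c| ^ p] over [A] gives [2 * s] as soon as the mean
    of [|g - c| ^ p] on [A] is at most [s ^ p]. *)
Lemma dist_mean_le A B g c p s K : measurable A -> measurable B -> A `<=` B ->
  (0 < mu A)%E -> (mu B < +oo)%E -> 0 < s -> 1 <= p ->
  fine (mu B) <= K * fine (mu A) ->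
  measurable_fun B g -> (forall y, 0 <= g y) ->
  mu.-integrable B (fun y => (g y `^ p)%:E) ->
  K * \int[mu]_(y in B) (`|g y - c| `^ p) <= s `^ p * fine (mu B) ->
  `| (fine (mu A))^-1 * \int[mu]_(y in A) g y - c | <= 2 * s.
Proof.
move=> mA mB AB A0 fB s0 p1 KAB mg g0 ig osc.
have p0 : 0 <= p by lra.
have fA : (mu A < +oo)%E by apply: le_lt_trans fB; rewrite le_measure ?inE.
have a0 : 0 < fine (mu A) by rewrite fine_gt0// A0.
have ic k : mu.-integrable A (EFin \o (fun=> k)).
  by apply: measurable_bounded_integrable; [| |exact: measurable_cst|
    exact: bounded_cst].
have iD : mu.-integrable B (EFin \o (fun y => `|g y - c| `^ p)).
  exact: integrable_powR_dist.
have iDA : mu.-integrable A (EFin \o (fun y => `|g y - c| `^ p)).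
  exact: integrableS iD.
have igA : mu.-integrable A (EFin \o g).
  exact/(integrableS mB mA AB)/(integrable_of_powR mB fB mg g0 p1).
have igc : mu.-integrable A (EFin \o (fun y => g y - c)).
  exact: (integrableB mA igA (ic c)).
have -> : (fine (mu A))^-1 * \int[mu]_(y in A) g y - c =
    (fine (mu A))^-1 * \int[mu]_(y in A) (g y - c).
  rewrite RintegralB// Rintegral_cst// mulrBr; congr (_ - _).
  by rewrite mulrCA mulVf ?mulr1// gt_eqF.
rewrite normrM ger0_norm ?invr_ge0 ?(ltW a0)// mulrC ler_pdivrMr//.
apply: le_trans (le_normr_Rintegral mA igc) _.
have DAB : \int[mu]_(y in A) (`|g y - c| `^ p) <= \int[mu]_(y in B) (`|g y - c| `^ p).
  rewrite fine_le ?integrable_fin_num//.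
  apply: ge0_subset_integral => //; first by case/integrableP : iD.
have iZ : mu.-integrable A (EFin \o (fun y => s `^ (1 - p) * `|g y - c| `^ p)).
  exact: (integrableZl mA _ iDA).
apply: (@le_trans _ _ (\int[mu]_(y in A) (s + s `^ (1 - p) * `|g y - c| `^ p))).
  apply: le_Rintegral => //.
  - exact: (integrable_norm igc).
  - exact: (integrableD mA (ic s) iZ).
  - by move=> y _; exact: le_powR_interp.
rewrite RintegralD// Rintegral_cst// RintegralZl//.
(* The factor [K] in the hypothesis pays for the passage from [B] to [A]: [K] times the oscillation
   is at most [s ^ p * mu B <= K * s ^ p * mu A]. *)
have Da : \int[mu]_(y in B) (`|g y - c| `^ p) <= s `^ p * fine (mu A).
  have D0 : 0 <= \int[mu]_(y in B) (`|g y - c| `^ p).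
    by apply: Rintegral_ge0 => y _; exact: powR_ge0.
  have b0 : 0 < fine (mu B).
    by rewrite (lt_le_trans a0)// fine_le ?ge0_fin_numE// le_measure ?inE.
  have K0 : 0 < K.
    by rewrite -(pmulr_lgt0 _ a0) (lt_le_trans b0).
  rewrite -(ler_pM2l K0) (le_trans osc)// mulrCA ler_wpM2l//.
  exact: powR_ge0.
have -> : 2 * s * fine (mu A) =
    s * fine (mu A) + s `^ (1 - p) * (s `^ p * fine (mu A)).
  rewrite mulrA -powRD ?subrK ?powRr1 ?ltW// ?oner_eq0//.
  by rewrite -mulrA mulr2n mulrDl mul1r.
by rewrite lerD2l ler_wpM2l ?powR_ge0// (le_trans DAB).
Qed.

(** One step from a ball [B] to the next ball [A]. The first bound on [M] lets half of [M * D]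
    absorb [2 ^ p * D], where [D] is the oscillation integral on [B]. The second makes what remains
    small enough for [dist_mean_le] with [s = eta * m]. *)
Lemma mean_step A B g p eta K M : measurable A -> measurable B -> A `<=` B ->
  (0 < mu A)%E -> (mu B < +oo)%E -> 0 < eta -> 1 <= p ->
  fine (mu B) <= K * fine (mu A) ->
  measurable_fun B g -> (forall y, 0 <= g y) ->
  mu.-integrable B (fun y => (g y `^ p)%:E) ->
  2 * 2 `^ p <= M -> K * (2 * 2 `^ p) <= M * eta `^ p ->
  let m := (fine (mu B))^-1 * \int[mu]_(y in B) g y in
  M * \int[mu]_(y in B) (`|g y - m| `^ p) < \int[mu]_(y in B) (g y `^ p) ->
  0 < m /\
  (1 - 2 * eta) * m <= (fine (mu A))^-1 * \int[mu]_(y in A) g y.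
Proof.
move=> mA mB AB A0 fB eta0 p1 KAB mg g0 ig M2 KM m lt_osc.
have p0 : 0 <= p by lra.
have p2 : 1 <= 2 `^ p.
  have : (1 : R) `^ p <= 2 `^ p by apply: ge0_ler_powR; rewrite ?nnegrE//; lra.
  by rewrite powR1.
have M0 : 0 < M by apply: lt_le_trans M2; lra.
set D := \int[mu]_(y in B) (`|g y - m| `^ p) in lt_osc.
have D0 : 0 <= D by apply: Rintegral_ge0 => y _; exact: powR_ge0.
have fA : (mu A < +oo)%E by apply: le_lt_trans fB; rewrite le_measure ?inE.
have a0 : 0 < fine (mu A) by rewrite fine_gt0// A0.
have b0 : 0 < fine (mu B).
  by rewrite (lt_le_trans a0)// fine_le ?ge0_fin_numE// le_measure ?inE.
have m0 : 0 < m.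
  have m0 : 0 <= m by rewrite mulr_ge0 ?invr_ge0 ?(ltW b0)// Rintegral_ge0.
  rewrite lt_neqAle m0 andbT {m0}.
  apply/eqP => m0; move: lt_osc; apply/negP; rewrite -leNgt.
  have <- : D = \int[mu]_(y in B) (g y `^ p).
    by apply: eq_Rintegral => y _; rewrite -m0 subr0 ger0_norm.
  rewrite ler_peMl//; lra.
split=> //.
have := Rintegral_powR_le m mB fB mg g0 p0 ig; rewrite -/D (gtr0_norm m0) => I_le.
suff : `|(fine (mu A))^-1 * \int[mu]_(y in A) g y - m| <= 2 * (eta * m).
  by rewrite ler_norml => /andP[+ _]; lra.
apply: (dist_mean_le mA mB AB A0 fB _ p1 KAB mg g0 ig); first exact: mulr_gt0.
rewrite -/D powRM; [|exact: ltW..].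
rewrite -(ler_pM2l M0).
have MD : M * D <= 2 * 2 `^ p * (m `^ p * fine (mu B)).
  have : 2 * 2 `^ p * D <= M * D by rewrite ler_wpM2r.
  move: lt_osc I_le; lra.
have K0 : 0 <= K by rewrite ltW// -(pmulr_lgt0 _ a0) (lt_le_trans b0).
have w0 : 0 <= m `^ p * fine (mu B) by rewrite mulr_ge0 ?powR_ge0 ?ltW.
have := ler_wpM2l K0 MD; have := ler_wpM2r w0 KM; lra.
Qed.

End oscillation.

(** * Measure of Euclidean balls by comparison with cubes *)

Section euclidean_balls.
Context {R : realType}.

(** Closed cubes are products, so their measure follows the recursion on the dimension, and they are
    compact, as [Lp_loc] requires. A center given as a function restricts easily to the last
    coordinates. *)
Definition box n (c : 'I_n -> R) (r : R) : set 'rV[R]_n :=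
  [set y | forall i, `[c i - r, c i + r]%classic (y ord0 i)].

Lemma measurable_box n (c : 'I_n -> R) r : measurable (box c r).
Proof.
rewrite (_ : box c r = \bigcap_(i in [set: 'I_n])
    ((fun y : 'rV[R]_n => y ord0 i) @^-1` `[c i - r, c i + r]%classic)).
  apply: fin_bigcap_measurable => // i _.
  by rewrite -[X in measurable X]setTI; exact: measurable_coord.
by apply/seteqP; split=> y /= yb i; [move=> _|]; exact: yb.
Qed.

Lemma borel_lebesgue_box n (c : 'I_n -> R) r : 0 <= r ->
  borel_lebesgue n (box c r) = ((2 * r) ^+ n)%:E.
Proof.
move=> r0; elim: n c => [c|n IH c] /=.
  by rewrite diracE mem_set// => -[].
have itvE : lebesgue_measure `[c ord0 - r, c ord0 + r]%classic = (2 * r)%:E.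
  rewrite lebesgue_measure_itv/= lte_fin.
  (* For [r = 0] the interval is a point and the length formula takes its zero branch. *)
  by case: ltP => h; rewrite -?EFinB; congr EFin; lra.
rewrite /lebesgue_row_step /pushforward.
rewrite (_ : _ @^-1` _ = `[c ord0 - r, c ord0 + r]%classic `*`
                         box (fun i => c (lift ord0 i)) r).
  rewrite product_measure1E//; last exact: measurable_box.
  by rewrite IH exprS EFinM; congr (_ * _)%E; exact: itvE.
apply/seteqP; split=> -[a v] /=.
  move=> yb; split; first by have := yb ord0; rewrite row_cons0.
  by move=> i; have := yb (lift ord0 i); rewrite row_consS.
move=> [ya yv] i; have [j ->|->] := unliftP ord0 i.
- by rewrite row_consS; exact: yv.
- by rewrite row_cons0.
Qed.

Lemma measurable_lebesgue_space n (A : set 'rV[R]_n) : measurable A ->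
  measurable (A : set (lebesgue_space n)).
Proof. by move=> mA; apply: sub_caratheodory; exact: sub_sigma_algebra. Qed.

Lemma lebesgue_measurable_box n (c : 'I_n -> R) r :
  measurable (box c r : set (lebesgue_space n)).
Proof. by apply: measurable_lebesgue_space; exact: measurable_box. Qed.

Lemma lebesgue_row_box n (c : 'I_n -> R) r : 0 <= r ->
  lebesgue_row n (box c r) = ((2 * r) ^+ n)%:E.
Proof.
move=> r0; rewrite -(borel_lebesgue_box c)// /lebesgue_row.
by rewrite /completed_measure_extension measurable_mu_extE//; exact: measurable_box.
Qed.

Lemma compact_box n (c : 'I_n -> R) r : compact (box c r).
Proof.
apply: (@rV_compact _ _ (fun i => `[c i - r, c i + r]%classic)) => i.
exact: segment_compact.
Qed.

Lemma measurable_eucl_ball n (x : 'rV[R]_n) r :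
  measurable (eucl_ball x r : set (lebesgue_space n)).
Proof.
apply: measurable_lebesgue_space.
(* Squaring the inequality that defines the ball requires [0 < r]; otherwise the ball is empty. *)
have [r0|r0] := leP r 0.
  rewrite (_ : eucl_ball x r = set0); first exact: measurable0.
  apply/seteqP; split=> y //=; rewrite /eucl_ball /= => h.
  by move: (lt_le_trans h r0); rewrite ltNge sqrtr_ge0.
rewrite (_ : eucl_ball x r =
    (fun y : 'rV[R]_n => \sum_i (y ord0 i - x ord0 i) ^+ 2) @^-1` `]-oo, r ^+ 2[%classic).
  rewrite -[X in measurable X]setTI.
  have : measurable_fun [set: 'rV[R]_n]
      (fun y : 'rV[R]_n => \sum_i (y ord0 i - x ord0 i) ^+ 2).
    apply: measurable_sum => i; apply: measurable_funX; apply: measurable_funB => //.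
    exact: measurable_coord.
  by move=> /(_ measurableT); apply; exact: measurable_itv.
have E y : (eucl_norm (y - x) < r) = (\sum_i (y ord0 i - x ord0 i) ^+ 2 < r ^+ 2).
  rewrite /eucl_norm -[in LHS](gtr0_norm r0) -sqrtr_sqr ltr_sqrt ?exprn_gt0//.
  by under eq_bigr do rewrite !mxE.
by apply/seteqP; split=> y; rewrite /eucl_ball /= in_itv /= E.
Qed.

Lemma eucl_ball_sub_box n (x : 'rV[R]_n) r : eucl_ball x r `<=` box (x ord0) r.
Proof.
move=> y; rewrite /eucl_ball /eucl_norm /= => yr i.
have : `|y ord0 i - x ord0 i| <= r.
  rewrite (le_trans _ (ltW yr))// -sqrtr_sqr ler_wsqrtr//.
  rewrite (bigD1 i)//= !mxE lerDl sumr_ge0// => j _.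
  exact: sqr_ge0.
by rewrite /= in_itv/= ler_distl.
Qed.

(** The squares sum to at most [n / (n + 1) ^ 2 * r ^ 2]. Dividing by [n + 1] keeps this strictly
    below [r ^ 2] and avoids both roots and division by zero. *)
Lemma box_sub_eucl_ball n (x : 'rV[R]_n) r : 0 < r ->
  box (x ord0) (r / n.+1%:R) `<=` eucl_ball x r.
Proof.
move=> r0 y yb; rewrite /eucl_ball /eucl_norm /=.
rewrite -[ltRHS](gtr0_norm r0) -sqrtr_sqr ltr_sqrt ?exprn_gt0//.
apply: (@le_lt_trans _ _ (\sum_(i < n) (r / n.+1%:R) ^+ 2)).
  apply: ler_sum => i _; rewrite !mxE -[leLHS]real_normK ?num_real//.
  rewrite lerXn2r ?nnegrE ?divr_ge0 ?(ltW r0)//.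
  by have := yb i; rewrite /= in_itv/= ler_distl.
rewrite sumr_const card_ord -[ltLHS]mulr_natr expr_div_n mulrAC.
rewrite ltr_pdivrMr ?exprn_gt0// ltr_pM2l ?exprn_gt0// -natrX ltr_nat.
by rewrite (leq_trans (ltnSn n))// leq_pmulr.
Qed.

Lemma lebesgue_row_eucl_ball_ltoo n (x : 'rV[R]_n) r : 0 < r ->
  (lebesgue_row n (eucl_ball x r) < +oo)%E.
Proof.
move=> r0; apply: (@le_lt_trans _ _ (lebesgue_row n (box (x ord0) r))).
  apply: le_measure; rewrite ?inE.
  - exact: measurable_eucl_ball.
  - exact: lebesgue_measurable_box.
  - exact: eucl_ball_sub_box.
by rewrite lebesgue_row_box ?ltry// ltW.
Qed.

Lemma lebesgue_row_eucl_ball_ge n (x : 'rV[R]_n) r : 0 < r ->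
  (((2 * (r / n.+1%:R)) ^+ n)%:E <= lebesgue_row n (eucl_ball x r))%E.
Proof.
move=> r0; rewrite -(lebesgue_row_box (x ord0)) ?divr_ge0 ?(ltW r0)//.
apply: le_measure; rewrite ?inE.
- exact: lebesgue_measurable_box.
- exact: measurable_eucl_ball.
- exact: box_sub_eucl_ball.
Qed.

Lemma lebesgue_row_eucl_ball_gt0 n (x : 'rV[R]_n) r : 0 < r ->
  (0 < lebesgue_row n (eucl_ball x r))%E.
Proof.
move=> r0; apply: lt_le_trans (lebesgue_row_eucl_ball_ge x r0).
by rewrite lte_fin exprn_gt0// mulr_gt0// divr_gt0.
Qed.

(** The large ball lies in a cube of side [2 * r] and the small one contains a cube of side
    [r / (n + 1)]; the constant is the ratio of their volumes, larger than the exact [2 ^ n] for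
    [n >= 1]. *)
Lemma eucl_ball_doubling n (x : 'rV[R]_n) r : 0 < r ->
  fine (lebesgue_row n (eucl_ball x r)) <=
  (2 * n.+1%:R) ^+ n * fine (lebesgue_row n (eucl_ball x (r / 2))).
Proof.
move=> r0; have r20 : 0 < r / 2 by rewrite divr_gt0.
apply: (@le_trans _ _ ((2 * r) ^+ n)).
  rewrite -[leRHS]/(fine ((2 * r) ^+ n)%:E) -(lebesgue_row_box (x ord0)) ?(ltW r0)//.
  apply: fine_le.
  - by rewrite ge0_fin_numE// lebesgue_row_eucl_ball_ltoo.
  - by rewrite lebesgue_row_box// ltW.
  - apply: le_measure; rewrite ?inE.
    + exact: measurable_eucl_ball.
    + exact: lebesgue_measurable_box.
    + exact: eucl_ball_sub_box.
have := lebesgue_row_eucl_ball_ge x r20.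
have fb : lebesgue_row n (eucl_ball x (r / 2)) \is a fin_num.
  by rewrite ge0_fin_numE// lebesgue_row_eucl_ball_ltoo.
rewrite -(fineK fb) lee_fin => h.
apply: (@le_trans _ _ ((2 * n.+1%:R) ^+ n * (2 * (r / 2 / n.+1%:R)) ^+ n)).
  by rewrite -exprMn (_ : 2 * n.+1%:R * _ = 2 * r)//; field; rewrite ?pnatr_eq0.
by rewrite ler_wpM2l ?exprn_ge0.
Qed.

(** [Lp_loc] controls integrals over compact sets, so the open ball is enclosed in a closed cube. *)
Lemma integrable_Lp_loc n (p r : R) (f : 'rV[R]_n -> R) (x : 'rV[R]_n) :
  Lp_loc p f ->
  (lebesgue_row n).-integrable (eucl_ball x r : set (lebesgue_space n))
    (fun y => (`|f y| `^ p)%:E).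
Proof.
move=> [mf If]; apply: (@integrableS _ _ _ _ (box (x ord0) r : set (lebesgue_space n))).
- exact: lebesgue_measurable_box.
- exact: measurable_eucl_ball.
- exact: eucl_ball_sub_box.
apply/integrableP; split.
  apply/measurable_EFinP; apply: (measurableT_comp (measurable_powR p)).
  by apply: measurableT_comp => //; exact: measurable_funTS.
under eq_integral do rewrite gee0_abs ?lee_fin ?powR_ge0//.
by apply: If; exact: compact_box.
Qed.

End euclidean_balls.

(** * Iteration along dyadic radii *)

Theorem lemma1p4 (R : realType) (n : nat) (hn : (1 <= n)%N)
    (eps p : R) (heps : 0 < eps) (hp : 1 <= p) :
  exists2 C : R, 0 < C &
    forall (f : 'rV[R]_n -> R) (x : 'rV[R]_n),
      Lp_loc p f ->
      mean_value (fun y => `|f y|) (eucl_ball x r) @[r --> 0^'+] --> 0 ->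
      forall r0 : R, 0 < r0 ->
        exists2 rho : R, 0 < rho < r0 &
          (\int[lebesgue_row n]_(y in eucl_ball x rho) (`|f y| `^ p)%:E <=
           (C * (r0 / rho) `^ eps)%:E *
           \int[lebesgue_row n]_(y in eucl_ball x rho)
             (`| `|f y| - mean_value (fun z => `|f z|) (eucl_ball x rho) | `^ p)%:E)%E.
Proof.
have p0 : 0 < p by lra.
(* Chosen so that [(q ^ k) ^ p = 2 ^ (- k * eps)] cancels the growth of [(r0 / rho k) ^ eps]. *)
pose q : R := 2 `^ (- (eps / p)).
have q0 : 0 < q by exact: powR_gt0.
have q1 : q < 1.
  rewrite /q powRN invf_lt1 ?powR_gt0//.
  have : (1 : R) `^ (eps / p) < 2 `^ (eps / p).
    by apply: gt0_ltr_powR; rewrite ?nnegrE ?divr_gt0 ?ltr1n.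
  by rewrite powR1.
pose delta : R := (1 - q) / 4.
have delta0 : 0 < delta by rewrite /delta; lra.
have delta1 : delta `^ p <= 1.
  have : delta `^ p <= 1 `^ p.
    by apply: ge0_ler_powR; rewrite ?nnegrE /delta; lra.
  by rewrite powR1.
pose K : R := (2 * n.+1%:R) ^+ n.
have K1 : 1 <= K by rewrite exprn_ege1// -natrM ler1n.
have p2 : 0 < 2 * 2 `^ p :> R by rewrite mulr_gt0// powR_gt0.
(* Dividing by [delta ^ p] meets the second bound on [M] in [mean_step] for all [k] at once; since
   [delta ^ p <= 1 <= K], the first bound holds too. *)
exists (K * (2 * 2 `^ p) / delta `^ p).
  by rewrite divr_gt0 ?mulr_gt0 ?powR_gt0//; lra.
move=> f x Lf mean0 r0 r00.
apply: contrapT => noball.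
(* The exponent [k + 1] makes already [rho 0] strictly smaller than [r0]. *)
pose rho k : R := r0 / 2 ^+ k.+1.
have rho0 k : 0 < rho k by rewrite divr_gt0// exprn_gt0.
have rhoS k : rho k.+1 = rho k / 2.
  by rewrite /rho [2 ^+ k.+2]exprSr invfM mulrA.
have rho_lt k : rho k < r0.
  by rewrite /rho ltr_pdivrMr ?exprn_gt0// ltr_pMr// exprn_egt1// ltr1n.
have mf : measurable_fun [set: lebesgue_space n] (fun y => `|f y|).
  by case: Lf => mf _; exact: measurableT_comp.
pose m k := mean_value (fun y => `|f y|) (eucl_ball x (rho k)).
have step k : 0 < m k /\ (1 - 2 * (delta * q ^+ k)) * m k <= m k.+1.
  set M := K * (2 * 2 `^ p) / delta `^ p * (r0 / rho k) `^ eps.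
  (* Since [r0 / rho k = 2 * 2 ^ k], the powers of [2 ^ k] cancel and only the factor [2 ^ eps >= 1]
     from the shifted exponent is left. *)
  have ME : M * (delta * q ^+ k) `^ p = K * (2 * 2 `^ p) * 2 `^ eps.
    rewrite /M; have -> : r0 / rho k = 2 * 2 ^+ k.
      by rewrite /rho exprS; field; rewrite !gt_eqF ?exprn_gt0.
    rewrite (powRM p (ltW delta0)) ?(powRM eps _ (exprn_ge0 k _)) ?exprn_ge0 ?(ltW q0)//.
    rewrite -!powR_mulrn ?(ltW q0)// -!powRrM.
    have -> : - (eps / p) * (k%:R * p) = - (k%:R * eps) by field; lra.
    rewrite powRN; field.
    by rewrite !gt_eqF ?powR_gt0.
  have r1 : 1 <= (r0 / rho k) `^ eps.
    have : 1 `^ eps <= (r0 / rho k) `^ eps.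
      apply: ge0_ler_powR; rewrite ?nnegrE ?divr_ge0 ?ltW//.
      by rewrite ltr_pdivlMr// mul1r.
    by rewrite powR1.
  have e2 : 1 <= (2 : R) `^ eps.
    have : 1 `^ eps <= (2 : R) `^ eps.
      by apply: ge0_ler_powR; rewrite ?nnegrE ?ler1n ?ltW.
    by rewrite powR1.
  have ig := integrable_Lp_loc (rho k) x Lf.
  have bfin := lebesgue_row_eucl_ball_ltoo x (rho0 k).
  have mB := measurable_eucl_ball x (rho k).
  have mfB := measurable_funTS mf.
  have iD := integrable_powR_dist (m k) mB bfin (mfB _)
    (fun y => normr_ge0 _) (ltW p0) ig.
  have eta0 : 0 < delta * q ^+ k by rewrite mulr_gt0 ?exprn_gt0.
  apply: (@mean_step _ (lebesgue_space n) R (lebesgue_row n)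
    (eucl_ball x (rho k.+1)) (eucl_ball x (rho k)) (fun y => `|f y|) p
    (delta * q ^+ k) K M) => //.
  - exact: measurable_eucl_ball.
  - move=> y /= /lt_trans; apply; rewrite rhoS ltr_pdivrMr//.
    by rewrite ltr_pMr// ltr1n.
  - exact: lebesgue_row_eucl_ball_gt0.
  - by rewrite rhoS; exact: eucl_ball_doubling.
  - apply: (@le_trans _ _ (K * (2 * 2 `^ p) / delta `^ p)).
      rewrite ler_pdivlMr ?powR_gt0//.
      by rewrite (le_trans (ler_piMr (ltW p2) delta1))// ler_peMl// ltW.
    by rewrite ler_peMr// divr_ge0 ?powR_ge0// mulr_ge0 ?(ltW p2)//; lra.
  - by rewrite ME ler_peMr// mulr_ge0 ?(ltW p2)//; lra.
  (* Both integrals are finite, so the real inequality [good] is equivalent to the extended real one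
     excluded by [noball]. *)
  - rewrite ltNge; apply/negP => good; apply: noball.
    exists (rho k); first by rewrite rho0 rho_lt.
    rewrite -(fineK (integrable_fin_num mB ig)).
    rewrite -(fineK (integrable_fin_num mB iD)) -EFinM lee_fin.
    exact: good.
have m_ge : forall k, m 0%N / 2 <= m k.
  apply: (ge_half_of_geometric_steps (q := q)); first by rewrite q0.
  - by move=> k; case: (step k).
  - by move=> k; case: (step k).
have m00 : 0 < m 0%N / 2 by rewrite divr_gt0// (step 0%N).1.
have rho_cvg : rho k @[k --> \oo] --> 0.
  have -> : rho = geometric (r0 / 2) 2^-1.
    by apply/funext => k; rewrite /rho /= exprS invfM exprVn mulrA.
  by apply: cvg_geometric; rewrite ger0_norm ?invf_lt1 ?ltr1n.
have m_cvg : m k @[k --> \oo] --> 0.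
  by have /cvg_at_rightP := mean0; apply; split.
have [N _ /(_ N (leqnn _))] := cvgr_lt 0 m_cvg _ m00.
by apply/negP; rewrite -leNgt.
Qed.
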